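(* Let $\mathfrak G=(\mathfrak X,\mathfrak E)$ be a finite $(q+1)$-regular graph. Let $0\neq z\in\mathbb C$ be a resonance of $\mathfrak G$ and let $u_+\in\mathcal D'(\mathfrak P^+)$ be a resonant state and $u_-\in\mathcal D'(\mathfrak P^-)$ a coresonant state associated with $z$, i.e. $u_\pm\ne 0$, $\mathcal L_+'u_+=zu_+$ and $\mathcal L_-'u_-=zu_-$. Then $$(z^2-q)\,\langle u_+,u_-\rangle_{(\mathfrak X)}=(z^2-1)\,\langle u_+,u_-\rangle_{\mathrm{geod}}.$$
   Context: Graphs. $\mathfrak G=(\mathfrak X,\mathfrak E)$ is a connected graph with vertex set $\mathfrak X$ and set of directed edges $\mathfrak E\subseteq\mathfrak X^2$, symmetric under switching the two vertices, without loops and without multiple edges, and $(q+1)$-regular: every vertex has exactly $q+1$ neighbors. For $\vec e=(a,b)\in\mathfrak E$ put $\iota(\vec e)=a$, $\tau(\vec e)=b$, $\vec e^{\,\mathrm{op}}=(b,a)$. Chains. $\mathfrak P^+$ is the set of infinite sequences $(\vec e_1,\vec e_2,\ldots)$ of directed edges that are concatenated, $\tau(\vec e_j)=\iota(\vec e_{j+1})$, and non-backtracking, $\tau(\vec e_{j+1})\neq\iota(\vec e_j)$, for all $j\ge1$. $\mathfrak P^-$ is the set of infinite sequences $(\ldots,\vec e_2,\vec e_1)$ of directed edges with $\tau(\vec e_{j+1})=\iota(\vec e_j)$ and $\iota(\vec e_{j+1})\ne\tau(\vec e_j)$ for all $j\ge 1$. The topology on $\mathfrak P^\pm$ is generated by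 the sets of all chains whose edges $\vec e_1,\ldots,\vec e_n$ equal a prescribed $n$-tuple ($n\in\mathbb N$). $C_c^{\mathrm{lc}}(\mathfrak P^\pm)$ is the space of locally constant compactly supported functions $\mathfrak P^\pm\to\mathbb C$ (for finite $\mathfrak G$ the spaces $\mathfrak P^\pm$ are compact), and $\mathcal D'(\mathfrak P^\pm)$ is its algebraic dual. Transfer operators. $(\mathcal L_+F)(\vec e_1,\vec e_2,\ldots)=\sum_{\vec e_0}F(\vec e_0,\vec e_1,\vec e_2,\ldots)$, the sum over all $\vec e_0\in\mathfrak E$ with $(\vec e_0,\vec e_1,\ldots)\in\mathfrak P^+$; $(\mathcal L_-F)(\ldots,\vec e_2,\vec e_1)=\sum_{\vec e_0}F(\ldots,\vec e_2,\vec e_1,\vec e_0)$, the sum over all $\vec e_0\in\mathfrak E$ with $(\ldots,\vec e_1,\vec e_0)\in\mathfrak P^-$. They preserve $C_c^{\mathrm{lc}}(\mathfrak P^\pm)$, and $\mathcal L_\pm'$ denotes the dual operator on $\mathcal D'(\mathfrak P^\pm)$. A number $z\in\mathbb C$ is a (co)resonance if $\mathcal L_+'$ (resp. $\mathcal L_-'$) has a nonzero eigenvector with eigenvalue $z$; such eigenvectors are called resonant (resp. coresonant) states. Pairings ($\mathfrak G$ finite). Let $\pi_+(\vec e_1,\ldots)=\iota(\vec e_1)$, $\pi_-(\ldots,\vec e_1)=\tau(\vec e_1)$, $\pi_+^{\mathfrak E}(\vec e_1,\ldots)=\vec e_1$, $\pi_-^{\mathfrak E}(\ldots,\vec e_1)=\vec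 e_1$. For $u_\pm\in\mathcal D'(\mathfrak P^\pm)$ put $(\pi_{\pm,*}u_\pm)(x)=\langle u_\pm,\mathbb 1_{\pi_\pm^{-1}(x)}\rangle$ for $x\in\mathfrak X$. The vertex pairing is $\langle u_+,u_-\rangle_{(\mathfrak X)}=\sum_{x\in\mathfrak X}(\pi_{+,*}u_+)(x)(\pi_{-,*}u_-)(x)$. The tensor product $u_+\otimes u_-$ is the linear functional on $C^{\mathrm{lc}}(\mathfrak P^-\times\mathfrak P^+)$ given by $\langle u_+\otimes u_-,\varphi\rangle=\langle u_+,\,c_+\mapsto\langle u_-,\varphi(\cdot,c_+)\rangle\rangle$. Let $\mathfrak P=\{(c_-,c_+)\in\mathfrak P^-\times\mathfrak P^+\mid \pi_-(c_-)=\pi_+(c_+),\ \pi_-^{\mathfrak E}(c_-)\neq\pi_+^{\mathfrak E}(c_+)^{\mathrm{op}}\}$ (an open and closed subset). The geodesic pairing is $\langle u_+,u_-\rangle_{\mathrm{geod}}=\langle u_+\otimes u_-,\mathbb 1_{\mathfrak P}\rangle$. *)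

(* Defs.v *)
From HB Require Import structures.
From mathcomp Require Import all_boot all_order all_algebra.
From mathcomp Require Import finmap.
From mathcomp Require Import all_classical all_reals all_analysis.
From mathcomp Require Import complex.

Set Implicit Arguments.
Unset Strict Implicit.
Unset Printing Implicit Defensive.

Import Order.TTheory GRing.Theory Num.Theory.

Local Open Scope classical_set_scope.
Local Open Scope ring_scope.


Section LocallyConstant.
Context (R : realType) (X : topologicalType).

Definition locally_constant (F : X -> R[i]) :=
  forall x, \forall y \near x, F y = F x.

Definition compactly_supported (F : X -> R[i]) :=
  compact (closure [set x | F x != 0]).

Definition lcc : {pred X -> (R[i])^o} :=
  [pred F | `[< locally_constant F /\ compactly_supported F >]].

Lemma lccP (F : X -> (R[i])^o) :
  reflect (locally_constant F /\ compactly_supported F) (F \in lcc).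
Proof. by apply: (iffP idP) => [/asboolP|H]; last exact/asboolP. Qed.

Lemma lcc_submod_closed : subsemimod_closed lcc.
Proof.
split; first split.
- apply/lccP; split; first by move=> x; apply: nearW.
  rewrite /compactly_supported.
  have -> : [set x | (0 : X -> (R[i])^o) x != 0] = set0.
    by apply/seteqP; split=> // x /=; rewrite eqxx.
  by rewrite closure0; exact: compact0.
- move=> F G /lccP[lF cF] /lccP[lG cG]; apply/lccP; split.
    by move=> x; near=> y; congr (_ + _); near: y; [exact: lF|exact: lG].
  apply: (@subclosed_compact _ _ (closure [set x | F x != 0] `|`
                                  closure [set x | G x != 0])).
  + exact: closed_closure.
  + exact: compactU.
  + rewrite -closureU; apply: closureS => x /=.
    case: (eqVneq (F x) 0) => [F0|]; last by left.
    case: (eqVneq (G x) 0) => [G0|]; last by right.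
    by move=> /negP[]; rewrite /GRing.add /= F0 G0 addr0.
- move=> a F /lccP[lF cF]; apply/lccP; split.
    by move=> x; near=> y; congr (_ * _); near: y; exact: lF.
  apply: (subclosed_compact _ cF); first exact: closed_closure.
  apply: closureS => x /=; apply: contra_neq => F0.
  by rewrite /GRing.scale /= F0 scaler0.
Unshelve. all: by end_near. Qed.

HB.instance Definition _ := GRing.isSubSemiModClosed.Build _ _ lcc lcc_submod_closed.

Record Clc := MkClc { Clc_fun :> X -> (R[i])^o; _ : Clc_fun \in lcc }.

HB.instance Definition _ := [isSub for Clc_fun].
HB.instance Definition _ := [Choice of Clc by <:].
HB.instance Definition _ := [SubChoice_isSubLmodule of Clc by <:].

End LocallyConstant.

Section Dual.
Context (R : realType).
Implicit Types X Y : topologicalType.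

(* Algebraic dual: no continuity is required. *)
Definition distr X := {scalar Clc R X}.

Definition dual_op X Y (L : {linear Clc R X -> Clc R Y}) (u : distr Y) :
  distr X := u \o L.

Definition eigenstate X (L : {linear Clc R X -> Clc R X}) (z : R[i])
    (u : distr X) :=
  (exists F, u F != 0) /\ (forall F, dual_op L u F = z * u F).

Lemma lcc_compact X (F : X -> R[i]) : compact [set: X] ->
  locally_constant F -> (F : X -> (R[i])^o) \in lcc (R := R) (X := X).
Proof.
move=> cX lF; apply/lccP; split=> //.
exact: (subclosed_compact (@closed_closure _ _) cX).
Qed.

Lemma locally_constant_indic X (A : set X) :
  clopen A -> locally_constant (\1_A : X -> R[i]).
Proof.
move=> [oA cA] x; have [Ax|nAx] := pselect (A x).
- apply: filterS (open_nbhs_nbhs (conj oA Ax)) => y Ay.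
  by rewrite !indicE !mem_set.
- have oA' : open (~` A) by exact: closed_openC.
  apply: filterS (open_nbhs_nbhs (conj oA' nAx)) => y nAy.
  by rewrite !indicE !memNset.
Qed.

Definition Clc_indic X (cX : compact [set: X]) (A : set X) (cA : clopen A) :
  Clc R X := MkClc (lcc_compact cX (locally_constant_indic cA)).

End Dual.

(* As X and Y are compact, C^lc(X * Y) is C_c^lc(X * Y) here. *)
Section Tensor.
Context (R : realType) (X Y : topologicalType).
Hypotheses (cX : compact [set: X]) (cY : compact [set: Y]).
Implicit Types (phi : Clc R (X * Y)%type) (u : distr R Y) (v : distr R X).

Lemma locally_constant_slice phi (y : Y) :
  locally_constant (fun x => phi (x, y) : R[i]).
Proof.
move=> x; have /lccP[lphi _] := valP phi.
have [[A B] /= [nA nB] AB] := lphi (x, y).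
apply: filterS nA => x' Ax'; apply: (AB (x', y)); split=> //=.
exact: nbhs_singleton.
Qed.

Definition slice phi (y : Y) : Clc R X :=
  MkClc (lcc_compact cX (locally_constant_slice phi y)).

Lemma near_slice phi (y : Y) : \forall y' \near y, slice phi y' = slice phi y.
Proof.
have /lccP[lphi _] := valP phi.
have /compact_near_coveringP/(_ Y (nbhs y)
  (fun y' x => phi (x, y') = phi (x, y)) _) := cX.
have H : forall x, [set: X] x ->
   \forall x' \near x & y' \near y, phi (x', y') = phi (x', y).
  move=> x _; have [[A B] /= [nA nB] AB] := lphi (x, y).
  exists (A, B) => //= -[x' y'] [/= Ax' By'].
  transitivity (phi (x, y)); first exact: (AB (x', y')).
  by apply/esym/(AB (x', y)); split => //=; exact: nbhs_singleton.
move=> /(_ H); apply: filterS => y' E.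
by apply: val_inj; apply/funext => x; exact: (E x I).
Qed.

Lemma locally_constant_pairing v phi :
  locally_constant (fun y => v (slice phi y)).
Proof. by move=> y; apply: filterS (near_slice phi y) => y' ->. Qed.

Definition pairing v phi : Clc R Y :=
  MkClc (lcc_compact cY (locally_constant_pairing v phi)).

Definition tensor_fun u v phi : R[i] := u (pairing v phi).

Lemma tensor_fun_is_scalar u v : scalar (tensor_fun u v).
Proof.
move=> a f g; rewrite /tensor_fun -linearP; congr (u _).
apply: val_inj; apply/funext => y /=.
transitivity (v (a *: slice f y + slice g y)); last by rewrite linearP.
by congr (v _); apply: val_inj; apply/funext => x.
Qed.

HB.instance Definition _ u v :=
  GRing.isLinear.Build R[i] (Clc R (X * Y)%type) R[i] *%R
    (tensor_fun u v) (tensor_fun_is_scalar u v).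

Definition tensor u v : distr R (X * Y)%type := tensor_fun u v.

End Tensor.


(* Sequences e_1, e_2, ... with [r e_j e_(j+1)] for all j; the edge e_j is the
   one of index j - 1. *)
Section Chain.
Context (E : finType) (r : rel E).

Record chain := Chain { edge_at :> nat -> E;
                        chain_step : forall n, r (edge_at n) (edge_at n.+1) }.

HB.instance Definition _ := gen_eqMixin chain.
HB.instance Definition _ := gen_choiceMixin chain.

Definition cylinder (s : seq E) : set chain :=
  [set c | mkseq c (size s) = s].

HB.instance Definition _ :=
  @isSubBaseTopological.Build chain (set chain) (range cylinder) id.

Lemma chain_inj (c d : chain) : c =1 d -> c = d.
Proof.
case: c d => [c hc] [d hd] /= /funext cd; subst d.
by congr Chain; exact: Prop_irrelevance.
Qed.

Lemma eq_mkseqP (f g : nat -> E) n :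
  (forall i, (i < n)%N -> f i = g i) <-> mkseq f n = mkseq g n.
Proof.
split=> [H|H i ilt].
  by apply/eq_in_map => i; rewrite mem_iota => /andP[_]; exact: H.
by rewrite -(nth_mkseq (f 0) f ilt) H nth_mkseq.
Qed.

Lemma nbhs_chainP (c : chain) (A : set chain) :
  nbhs c A <->
  exists n, forall d : chain, (forall i, (i < n)%N -> d i = c i) -> A d.
Proof.
split.
  case=> _ [[D HD <-] [B DB Bc] DA].
  have [J [sJ eJ]] : exists J : {fset (set chain)},
      {subset J <= range cylinder} /\ \bigcap_(C in [set` J]) C = B.
    by have [J sJ eJ] := HD _ DB; exists J.
  have : exists n, forall C, C \in J ->
      forall d : chain, (forall i, (i < n)%N -> d i = c i) -> C d.
    have : forall C, C \in J -> C c.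
      by move=> C CJ; move: Bc; rewrite -eJ; apply.
    have : forall C, C \in J -> range cylinder C.
      by move=> C /sJ; rewrite inE.
    move: Bc DB => _ _; elim/finSet_rect: J {sJ eJ} => J IH HJ Jc.
    have [->|[C CJ]] := fset_0Vmem J; first by exists 0 => C; rewrite inE.
    have [||| n Hn] := IH (J `\ C)%fset.
    - exact: fproperD1.
    - by move=> C' /fsetD1P[_]; exact: HJ.
    - by move=> C' /fsetD1P[_]; exact: Jc.
    have [s _ Cs] := HJ _ CJ.
    exists (maxn n (size s)) => C' C'J d dc.
    have [->|C'C] := eqVneq C' C.
      have := Jc _ CJ; rewrite -Cs /cylinder /= => {2}<-.
      by apply/eq_mkseqP => i ilt; apply: dc; rewrite leq_max ilt orbT.
    apply: (Hn C'); first by apply/fsetD1P.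
    by move=> i ilt; apply: dc; rewrite leq_max ilt.
  move=> [n Hn]; exists n => d dc; apply: DA; exists B => //.
  have Bd : (\bigcap_(C in [set` J]) C) d by move=> C CJ; exact: Hn dc.
  by rewrite eJ in Bd.
move=> [n Hn]; exists (cylinder (mkseq c n)); split.
- exists [set cylinder (mkseq c n)]; last by rewrite bigcup_set1.
  move=> _ ->; exists [fset (cylinder (mkseq c n))]%fset.
    by move=> B /fset1P ->; rewrite inE; exists (mkseq c n).
  apply/seteqP; split=> d; last by move=> H B /= /fset1P ->.
  by move=> /(_ (cylinder (mkseq c n))); apply; rewrite /= inE.
- by rewrite /cylinder /= size_mkseq.
- by move=> d; rewrite /cylinder /= size_mkseq => /eq_mkseqP; exact: Hn.
Qed.

Lemma near_agree (c : chain) n :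
  \forall d \near c, forall i, (i < n)%N -> (d : chain) i = c i.
Proof. by apply/nbhs_chainP; exists n. Qed.

Lemma compact_chain : compact [set: chain].
Proof.
rewrite compact_ultra => U UU _.
have pick n : exists e, U [set c : chain | c n = e].
  have : forall s : seq E, U [set c : chain | c n \in s] ->
      exists e, U [set c : chain | c n = e].
    elim=> [|e s IH] Us.
      by have /filter_ex[? []] : U set0 by apply: filterS Us => c /=; rewrite in_nil.
    have [He|He] := in_ultra_setVsetC [set c : chain | c n = e] UU.
      by exists e.
    apply: IH; apply: filterS (filterI He Us) => c [/= ce].
    by rewrite inE => /orP[/eqP|].
  move=> /(_ (enum E)); apply; apply: filterS (@filterT _ U _) => c _ /=.
  exact: mem_enum.
pose f n := projT1 (cid (pick n)).
have Uf n : U [set c : chain | forall i, (i < n)%N -> c i = f i].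
  elim: n => [|n IH]; first by apply: filterS (@filterT _ U _).
  apply: filterS (filterI IH (projT2 (cid (pick n)))) => c [/= H Hn] i.
  by rewrite ltnS leq_eqVlt => /orP[/eqP ->|]; [exact: Hn|exact: H].
have rf n : r (f n) (f n.+1).
  have /filter_ex[c Hc] := Uf n.+2.
  by rewrite -(Hc n) // -(Hc n.+1) //; exact: chain_step.
exists (Chain rf); split=> // A /nbhs_chainP[n Hn].
by apply: filterS (Uf n) => d; exact: Hn.
Qed.

Lemma clopen_chain (A : set chain) n :
  (forall c d : chain, (forall i, (i < n)%N -> d i = c i) -> A c -> A d) ->
  clopen A.
Proof.
move=> H; split.
  by rewrite openE => c Ac; apply/nbhs_chainP; exists n => d /H; apply.
move=> c /(_ _ (near_agree c n))[d [Ad dc]].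
by apply: H Ad => i ilt; rewrite dc.
Qed.

Definition ccons (c : chain) (e : {e : E | r e (c 0)}) : chain :=
  @Chain (fun n => if n is m.+1 then c m else val e)
    (fun n => match n with 0 => valP e | m.+1 => chain_step c m end).

Section Transfer.
Context (R : realType).

Definition transfer_fun (F : chain -> R[i]) (c : chain) : R[i] :=
  \sum_(e : {e : E | r e (c 0)}) F (ccons e).

Lemma locally_constant_uniform (F : chain -> R[i]) : locally_constant F ->
  exists n, forall c d : chain, (forall i, (i < n)%N -> d i = c i) -> F d = F c.
Proof.
move=> lF.
have /compact_near_coveringP/(_ nat \oo (fun n (c : chain) =>
  forall d : chain, (forall i, (i < n)%N -> d i = c i) -> F d = F c) _) :=
  compact_chain.
case=> [c _|n _ Hn]; last by exists n => c; exact: (Hn n (leqnn n) c I).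
have /nbhs_chainP[m Hm] := lF c.
exists ([set d : chain | forall i, (i < m)%N -> d i = c i], [set n | (m <= n)%N]).
  by split=> /=; [exact: near_agree|exists m].
move=> [d n] [/= dc mn] d' d'd; rewrite (Hm d)//; apply: Hm => i im.
by rewrite d'd ?dc// (leq_trans im).
Qed.

Lemma locally_constant_transfer (F : chain -> R[i]) :
  locally_constant F -> locally_constant (transfer_fun F).
Proof.
move=> /locally_constant_uniform[n Hn] c.
apply: filterS (near_agree c n.+1) => d dc.
have d0 : d 0 = c 0 by exact: dc.
have cast (x y : E) : x = y -> forall e, r e x -> r e y by move=> ->.
pose f (e : {e : E | r e (c 0)}) : {e : E | r e (d 0)} :=
  exist _ (val e) (cast _ _ (esym d0) _ (valP e)).
pose g (e : {e : E | r e (d 0)}) : {e : E | r e (c 0)} :=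
  exist _ (val e) (cast _ _ d0 _ (valP e)).
rewrite /transfer_fun (reindex f); last first.
  by exists g => e _; apply: val_inj.
apply: eq_bigr => e _; apply: Hn => -[|i] //= ilt.
by apply: dc; rewrite ltnS; exact: ltnW (ltnW ilt).
Qed.

Lemma Clc_locally_constant (F : Clc R chain) :
  locally_constant (F : chain -> R[i]).
Proof. by have /lccP[] := valP F. Qed.

Definition transfer (F : Clc R chain) : Clc R chain :=
  MkClc (lcc_compact compact_chain
    (locally_constant_transfer (Clc_locally_constant F))).

Lemma transfer_is_linear : linear transfer.
Proof.
move=> a F G; apply: val_inj; apply/funext => c /=.
rewrite {1}/transfer_fun big_split /=; congr (_ + _).
by rewrite -scaler_sumr.
Qed.

HB.instance Definition _ := GRing.isLinear.Build R[i] (Clc R chain)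
  (Clc R chain) *:%R transfer transfer_is_linear.

End Transfer.
End Chain.


Record graph := Graph {
  vertex :> finType;
  adj : rel vertex;
  adj_sym : symmetric adj;
  adj_irrefl : irreflexive adj;
  adj_connected : forall x y, connect adj x y }.

Definition regular (G : graph) (k : nat) :=
  forall x : G, #|[set y | adj x y]%SET| = k.

Section GraphChains.
Context (G : graph).

Definition edge := {e : G * G | adj e.1 e.2}.
Definition iota_e (e : edge) : G := (val e).1.
Definition tau_e (e : edge) : G := (val e).2.

Lemma op_subproof (e : edge) : adj (tau_e e) (iota_e e).
Proof. by rewrite adj_sym; exact: valP e. Qed.

Definition op (e : edge) : edge := exist _ (tau_e e, iota_e e) (op_subproof e).

(* (e, f) is a non-backtracking concatenation. *)
Definition follows : rel edge :=
  fun e f => (tau_e e == iota_e f) && (tau_e f != iota_e e).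

(* A chain (..., e_2, e_1) of P^- is read from right to left: e_1 has index 0,
   e_(j+1) precedes e_j on the path, and [ccons] appends e_0 at the right end. *)
Definition Pplus := chain follows.
Definition Pminus := chain (fun e f => follows f e).

Definition piE_plus (c : Pplus) : edge := c 0.
Definition piE_minus (c : Pminus) : edge := c 0.
Definition pi_plus (c : Pplus) : G := iota_e (c 0).
Definition pi_minus (c : Pminus) : G := tau_e (c 0).

Lemma clopen_fiber_plus (x : G) : clopen (pi_plus @^-1` [set x]).
Proof.
by apply: (@clopen_chain _ _ _ 1) => c d dc; rewrite /pi_plus /= dc.
Qed.

Lemma clopen_fiber_minus (x : G) : clopen (pi_minus @^-1` [set x]).
Proof.
by apply: (@clopen_chain _ _ _ 1) => c d dc; rewrite /pi_minus /= dc.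
Qed.

Definition geodesics : set (Pminus * Pplus) :=
  [set c | pi_minus c.1 = pi_plus c.2 /\ piE_minus c.1 <> op (piE_plus c.2)].

Lemma clopen_geodesics : clopen geodesics.
Proof.
have near0 (c : Pminus * Pplus) :
    \forall d \near c, (d : Pminus * Pplus).1 0 = c.1 0 /\ d.2 0 = c.2 0.
  exists ([set d : Pminus | forall i, (i < 1)%N -> d i = c.1 i],
          [set d : Pplus | forall i, (i < 1)%N -> d i = c.2 i]).
    by split; exact: near_agree.
  by move=> d [/= d1 d2]; rewrite d1 ?d2.
have E (c d : Pminus * Pplus) :
    d.1 0 = c.1 0 /\ d.2 0 = c.2 0 -> geodesics d = geodesics c.
  by case=> d1 d2; rewrite /geodesics /pi_minus /pi_plus /piE_minus /piE_plus
    /= d1 d2.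
split; first by rewrite openE => c gc; apply: filterS (near0 c) => d /E ->.
by move=> c /(_ _ (near0 c))[d [gd /E <-]].
Qed.

Lemma compact_Pminus_Pplus : compact [set: Pminus * Pplus].
Proof. by rewrite -setXTT; apply: compact_setX; exact: compact_chain. Qed.

Context (R : realType).

Definition L_plus : {linear Clc R Pplus -> Clc R Pplus} :=
  @transfer edge follows R.
Definition L_minus : {linear Clc R Pminus -> Clc R Pminus} :=
  @transfer edge (fun e f => follows f e) R.

Definition resonant_state (z : R[i]) (u : distr R Pplus) :=
  eigenstate L_plus z u.
Definition coresonant_state (z : R[i]) (u : distr R Pminus) :=
  eigenstate L_minus z u.
Definition resonance (z : R[i]) := exists u, resonant_state z u.

Definition push_plus (u : distr R Pplus) (x : G) : R[i] :=
  u (Clc_indic R (@compact_chain _ _) (clopen_fiber_plus x)).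
Definition push_minus (u : distr R Pminus) (x : G) : R[i] :=
  u (Clc_indic R (@compact_chain _ _) (clopen_fiber_minus x)).

Definition vertex_pairing (up : distr R Pplus) (um : distr R Pminus) : R[i] :=
  \sum_(x : G) push_plus up x * push_minus um x.

Definition geodesic_pairing (up : distr R Pplus) (um : distr R Pminus) : R[i] :=
  tensor (@compact_chain _ _) (@compact_chain _ _) up um
    (Clc_indic R compact_Pminus_Pplus clopen_geodesics).

End GraphChains.

(* Main.v *)
(** Write [a e] and [b e] for the values of [u_plus] and [u_minus] on the
    chains with [e_1 = e], and [A x], [B x] for their sums over [iota e = x], resp.
    [tau e = x]. The eigenvalue equations read
    [z a(e) + a(op e) = A(tau e)] and [z b(e) + b(op e) = B(iota e)], and solving
    the latter gives [(z^2 - 1) b(op e) = z B(tau e) - B(iota e)].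
    With [V = sum_x A(x) B(x)] the vertex pairing, summing the first equation
    against [B(tau e)] yields [z sum_e a(e) B(tau e) = q V], whence
    [(z^2 - 1) D = (q - 1) V] for [D = sum_e a(e) b(op e)]. The geodesic
    pairing is [V - D]. *)
Require Import Defs.
From mathcomp Require Import all_boot all_order all_algebra.
From mathcomp Require Import all_classical all_reals all_analysis.
From mathcomp Require Import complex ring.

Import GRing.Theory.

Local Open Scope classical_set_scope.
Local Open Scope ring_scope.

Section FirstEdge.
Context (R : realType) (E : finType) (r : rel E).
Implicit Types (e : E) (u : distr R (chain r)) (F : Clc R (chain r)).

Lemma clopen_first_edge e : clopen [set c : chain r | c 0 = e].
Proof. by apply: (@clopen_chain _ _ _ 1) => c d dc /=; rewrite dc. Qed.

Definition first_edge_indic e : Clc R (chain r) :=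
  Clc_indic R (@compact_chain _ r) (clopen_first_edge e).

Lemma first_edge_indicE e (c : chain r) : first_edge_indic e c = (c 0 == e)%:R.
Proof. by rewrite /= indicE; congr (nat_of_bool _)%:R; apply/idP/eqP; rewrite inE. Qed.

Definition mass u e : R[i] := u (first_edge_indic e).

(** [F] is a finite combination of first-edge indicators, so [u F] is fixed by the masses alone;
    this reduces everything below to sums over the finite edge set. *)
Lemma distr_first_edge u F (g : E -> R[i]) :
  (forall c : chain r, F c = g (c 0)) -> u F = \sum_e g e * mass u e.
Proof.
move=> Fg; have -> : F = \sum_e g e *: first_edge_indic e.
  apply: val_inj; rewrite raddf_sum /=; apply/funext => c.
  rewrite fct_sumE Fg (bigD1 (c 0)) //= big1 ?addr0 => [|e ne].
    rewrite -[RHS]/(g (c 0) * first_edge_indic (c 0) c).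
    by rewrite first_edge_indicE eqxx mulr1.
  rewrite -[LHS]/(g e * first_edge_indic e c).
  by rewrite first_edge_indicE eq_sym (negPf ne) mulr0.
by rewrite linear_sum; apply: eq_bigr => e _; rewrite linearZ.
Qed.

(** Among the one-edge extensions of [c], only the one by [e] contributes, and it exists exactly
    when [r e (c 0)]. *)
Lemma transfer_first_edge e (c : chain r) :
  transfer (first_edge_indic e) c = (r e (c 0))%:R.
Proof.
rewrite -[LHS]/(\sum_(f : {f | r f (c 0)}) first_edge_indic e (ccons f)).
under eq_bigr do rewrite first_edge_indicE /=.
have [rec|nrec] := boolP (r e (c 0)); last first.
  by apply: big1 => -[f rf] _ /=; case: eqP => // fe; move: nrec; rewrite -fe rf.
rewrite (bigD1 (exist _ e rec)) //= eqxx big1 ?addr0 // => f.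
by rewrite -val_eqE /= => /negPf ->.
Qed.

(** Keeping [r] generic serves both chain spaces: for [Pminus] the sum runs over the edges [f] with
    [follows f e]. *)
Lemma eigenstate_mass (z : R[i]) u e :
  eigenstate (@transfer E r R) z u -> z * mass u e = \sum_(f | r e f) mass u f.
Proof.
case=> _ /(_ (first_edge_indic e)); rewrite -[u _]/(mass u e) => <-.
rewrite /dual_op /= (@distr_first_edge _ _ (fun f => (r e f)%:R)).
  by rewrite [RHS]big_mkcond; apply: eq_bigr => f _; case: (r e f);
    rewrite ?mul1r ?mul0r.
by move=> c; exact: transfer_first_edge.
Qed.

End FirstEdge.

Arguments mass {R E r} u e.

Section Edges.
Context (G : graph).
Implicit Types e f : edge G.

Lemma opK : involutive (@op G).
Proof. by move=> e; apply: val_inj; case: e => -[]. Qed.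

Lemma edge_eqE e f : (e == f) = (iota_e e == iota_e f) && (tau_e e == tau_e f).
Proof. by rewrite -val_eqE; case: e => -[a b] ?; case: f => -[c d] ?. Qed.

Lemma followsE e f : follows e f = (iota_e f == tau_e e) && (f != op e).
Proof.
rewrite /follows eq_sym edge_eqE -[iota_e (op e)]/(tau_e e).
by case: (iota_e f == tau_e e).
Qed.

Lemma followsE_l e f : follows e f = (tau_e e == iota_e f) && (e != op f).
Proof. by rewrite followsE eq_sym -(inj_eq (inv_inj opK)) opK [op f == e]eq_sym. Qed.

Lemma sum_tau (V : pzSemiRingType) q (h : G -> V) : regular G q.+1 ->
  \sum_e h (tau_e e) = q.+1%:R * \sum_x h x.
Proof.
move=> Greg; rewrite (partition_big (@tau_e G) predT) //= mulr_sumr.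
apply: eq_bigr => x _; rewrite (eq_bigr (fun=> h x)) => [|e /eqP -> //].
rewrite sumr_const mulr_natl; congr (_ *+ _); rewrite -(Greg x).
(* Edges ending at [x] are counted by their initial vertices, since an edge is determined by its two
   endpoints. *)
rewrite -(card_in_imset (f := @iota_e G)).
  apply: eq_card => y; apply/imsetP/idP => [[e]|].
    by rewrite !inE => /eqP <- ->; exact: op_subproof.
  rewrite inE adj_sym => yx; exists (exist _ (y, x) yx) => //.
  exact: eqxx.
move=> e f /eqP te /eqP tf ief.
by apply/eqP; rewrite edge_eqE ief te tf !eqxx.
Qed.

End Edges.

Section Pairings.
Context (R : realType) (G : graph).
Variables (u : distr R (Pplus G)) (v : distr R (Pminus G)).

Lemma push_plusE x : push_plus u x = \sum_(e | iota_e e == x) mass u e.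
Proof.
rewrite /push_plus (@distr_first_edge _ _ _ _ _ (fun e => (iota_e e == x)%:R)).
  by rewrite [RHS]big_mkcond; apply: eq_bigr => e _; case: eqP;
    rewrite ?mul1r ?mul0r.
by move=> c /=; rewrite indicE; congr (nat_of_bool _)%:R; apply/idP/eqP; rewrite inE.
Qed.

Lemma push_minusE x : push_minus v x = \sum_(e | tau_e e == x) mass v e.
Proof.
rewrite /push_minus (@distr_first_edge _ _ _ _ _ (fun e => (tau_e e == x)%:R)).
  by rewrite [RHS]big_mkcond; apply: eq_bigr => e _; case: eqP;
    rewrite ?mul1r ?mul0r.
by move=> c /=; rewrite indicE; congr (nat_of_bool _)%:R; apply/idP/eqP; rewrite inE.
Qed.

Lemma sum_mass_push (h : G -> R[i]) :
  \sum_e mass u e * h (iota_e e) = \sum_x push_plus u x * h x.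
Proof.
rewrite (partition_big (@iota_e G) predT) //=; apply: eq_bigr => x _.
by rewrite push_plusE mulr_suml; apply: eq_bigr => e /eqP ->.
Qed.

(** When the plus chain starts with [f], the admissible minus chains are those ending at [iota_e f],
    except those whose last edge is [op f]. *)
Lemma geodesic_pairingE : geodesic_pairing u v =
  vertex_pairing u v - \sum_e mass u e * mass v (op e).
Proof.
rewrite /geodesic_pairing /tensor /= /tensor_fun.
(* [g f] is the value of [v] on the slice of the indicator of [geodesics] at any plus chain starting
   with [f]. *)
pose g f := \sum_e (follows e f)%:R * mass v e.
rewrite (@distr_first_edge _ _ _ _ _ g); last first.
  move=> c /=; apply: distr_first_edge => d /=.
  rewrite indicE followsE_l; congr (nat_of_bool _)%:R.
  apply/idP/andP; rewrite inE /geodesics /=.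
    by case=> de ne; split; [apply/eqP | apply/eqP].
  by case=> /eqP de /eqP ne; split.
rewrite /vertex_pairing -sum_mass_push -sumrB; apply: eq_bigr => f _.
rewrite -mulrBr mulrC; congr (_ * _).
rewrite push_minusE (bigD1 (op f)) ?eqxx //= [X in X - _]addrC addrK /g.
rewrite [RHS]big_mkcond; apply: eq_bigr => e _; rewrite followsE_l.
by case: andP; rewrite ?mul1r ?mul0r.
Qed.

Variable z : R[i].

(** Of all edges leaving [tau_e e], only [op e] backtracks and is missing from the eigenvalue
    sum. *)
Lemma resonant_mass e : resonant_state z u ->
  z * mass u e = push_plus u (tau_e e) - mass u (op e).
Proof.
move=> /eigenstate_mass ->; rewrite push_plusE [X in _ = X - _](bigD1 (op e)) ?eqxx //=.
by rewrite [X in X - _]addrC addrK; apply: eq_bigl => f; rewrite followsE.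
Qed.

Lemma coresonant_mass e : coresonant_state z v ->
  z * mass v e = push_minus v (iota_e e) - mass v (op e).
Proof.
move=> /eigenstate_mass ->; rewrite push_minusE [X in _ = X - _](bigD1 (op e)) ?eqxx //=.
by rewrite [X in X - _]addrC addrK; apply: eq_bigl => f; rewrite followsE_l.
Qed.

End Pairings.

Theorem mainTheorem1 (R : realType) (G : graph) (q : nat)
    (Greg : regular G q.+1) (z : R[i])
    (z_neq0 : z != 0) (z_res : resonance G z)
    (u_plus : distr R (Pplus G)) (u_minus : distr R (Pminus G))
    (u_plus_res : resonant_state z u_plus)
    (u_minus_res : coresonant_state z u_minus) :
  (z ^+ 2 - q%:R) * vertex_pairing u_plus u_minus =
  (z ^+ 2 - 1) * geodesic_pairing u_plus u_minus.
Proof.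
rewrite geodesic_pairingE.
set V := vertex_pairing _ _; set D := \sum_e _.
pose a := mass u_plus; pose b := mass u_minus.
pose A := push_plus u_plus; pose B := push_minus u_minus.
pose X := \sum_e a e * B (tau_e e).
have VE : \sum_e a e * B (iota_e e) = V by exact: sum_mass_push.
have zX : z * X = q%:R * V.
  transitivity (\sum_e (A (tau_e e) * B (tau_e e) - a (op e) * B (tau_e e))).
    rewrite mulr_sumr; apply: eq_bigr => e _.
    by rewrite mulrA (@resonant_mass _ _ _ z) // mulrBl.
  rewrite sumrB (@sum_tau _ _ _ (fun x => A x * B x) Greg) -/V.
  (* Reversing edges turns the subtracted sum into the one in [VE], leaving [q.+1] copies of [V]
     minus one. *)
  rewrite (reindex_inj (inv_inj (@opK G))) /=.
  under [X in _ - X]eq_bigr do rewrite opK.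
  by rewrite VE -natr1 mulrDl mul1r addrK.
have zD : (z ^+ 2 - 1) * D = z * X - V.
  (* The identity holds edge by edge. Expressing both values of [B] through [b] avoids dividing by
     [z ^+ 2 - 1], so [z = 1] and [z = -1] are covered. *)
  rewrite -VE !mulr_sumr -sumrB; apply: eq_bigr => e _.
  have bop : z * b (op e) = B (tau_e e) - b e.
    by rewrite [LHS](@coresonant_mass _ _ _ z) // opK.
  have be : z * b e = B (iota_e e) - b (op e) by exact: coresonant_mass.
  have -> : B (tau_e e) = z * b (op e) + b e by rewrite bop subrK.
  have -> : B (iota_e e) = z * b e + b (op e) by rewrite be subrK.
  by rewrite -/(a e) -/(b (op e)); ring.
(* Here [(z ^+ 2 - 1) * D] becomes [q%:R * V - V]; subtracting it from [(z ^+ 2 - 1) * V] leaves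
   [(z ^+ 2 - q%:R) * V]. *)
by rewrite mulrBr zD zX; ring.
Qed.
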